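(* Let $I\subset(0,\infty)$ be an interval, let $f:I\to\mathbb{R}$ be differentiable on $I^{\circ}$, and let $a,b\in I$ with $a<b$, where $f'$ exists at every point of $[a,b]$ (one-sided derivative at $a$ or $b$ if that point is an endpoint of $I$), and $f'\in L[a,b]$. Let $q>1$, $\frac1p+\frac1q=1$, and suppose $|f'|^q$ is harmonically convex on $[a,b]$. Then $$\left|f\left(\frac{2ab}{a+b}\right)-\frac{ab}{b-a}\int_a^b\frac{f(x)}{x^2}\,dx\right|\le\frac{ab(b-a)}{4(p+1)^{1/p}}\cdot\frac{1}{\left[(1-q)(1-2q)(b-a)^2\right]^{1/q}}$$ $$\times\Big\{\big(C_5(q;a,b)|f'(a)|^q+C_6(q;a,b)|f'(b)|^q\big)^{\frac1q}+\big(C_6(q;b,a)|f'(a)|^q+C_5(q;b,a)|f'(b)|^q\big)^{\frac1q}\Big\},$$ where, for $u,\vartheta>0$, $$C_5(q;u,\vartheta)=\left(\frac{u+\vartheta}{2}\right)^{1-2q}\left[\frac{\vartheta-3u}{2}-q(\vartheta-u)\right]+u^{2-2q},$$ $$C_6(q;u,\vartheta)=\left(\frac{u+\vartheta}{2}\right)^{1-2q}\left[\frac{3\vartheta-u}{2}-q(\vartheta-u)\right]+u^{1-2q}\left[u-2\vartheta+2q(\vartheta-u)\right].$$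
   Context: A function $g:J\to\mathbb{R}$ on an interval $J\subset\mathbb{R}\setminus\{0\}$ is harmonically convex if $g\left(\frac{xy}{tx+(1-t)y}\right)\le t\,g(y)+(1-t)\,g(x)$ for all $x,y\in J$ and $t\in[0,1]$. $L[a,b]$ denotes the Lebesgue integrable functions on $[a,b]$. *)

(* Defs.v *)
From mathcomp Require Import all_boot all_order all_algebra.
From mathcomp Require Import all_classical all_reals all_analysis.

Set Implicit Arguments.
Unset Strict Implicit.
Unset Printing Implicit Defensive.

Import Order.TTheory GRing.Theory Num.Theory numFieldNormedType.Exports.

Local Open Scope classical_set_scope.
Local Open Scope ring_scope.

Section Defs.
Context {R : realType}.
Implicit Types (I J : set R) (f g : R -> R) (q u v x : R).

(* A real function on a set I is represented by a total function f : R -> R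
   of which only the values on I matter. The derivative of f at x relative to
   I is the limit of the difference quotient at y as y tends to x with y in I
   and y != x. It is the usual derivative when x is interior to I, and the
   one-sided derivative when x is an endpoint of the interval I. *)
Definition diff_quotient f x : R -> R := fun y => (f y - f x) / (y - x).

Definition derivable_within I f x : Prop :=
  cvg (diff_quotient f x @ within I x^').

Definition derive_within I f x : R :=
  lim (diff_quotient f x @ within I x^').

Lemma within_dnbhs_interior I x : I° x -> within I x^' = x^'.
Proof.
move=> Ix; rewrite eqEsubset; split=> A xA; last by apply: filterS xA.
have Ix' : x^' I by exact: nbhs_dnbhs.
by apply: filterS2 Ix' xA => y Iy; apply.
Qed.

Lemma diff_quotient_shift f x :
  diff_quotient f x @ x^' = (h^-1 *: (f (h + x) - f x)) @[h --> 0^'].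
Proof.
apply/funext => A; apply/propext => /=.
rewrite [X in X <-> _]
  (near_shift 0 x (fun y => y != x -> A (diff_quotient f x y))) /= subr0.
change (nbhs (0 : R) (fun h => h + x != x -> A (diff_quotient f x (h + x))) <->
        nbhs (0 : R) (fun h => h != 0 -> A (h^-1 *: (f (h + x) - f x)))).
under eq_fun => h do
  rewrite -subr_eq0 addrK /diff_quotient addrK [_ / h]mulrC.
by [].
Qed.

Lemma derivable_within_interior I f x : I° x ->
  derivable_within I f x <-> derivable f x 1.
Proof.
move=> Ix; rewrite /derivable_within within_dnbhs_interior//.
rewrite diff_quotient_shift /derivable.
by under [X in _ <-> cvg (X @ _)]eq_fun do rewrite [_ *: 1]mulr1.
Qed.

Lemma derive_within_interior I f x : I° x -> derive_within I f x = derive1 f x.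
Proof.
by move=> Ix; rewrite /derive_within within_dnbhs_interior// diff_quotient_shift.
Qed.

Definition harmonically_convex_on J g : Prop :=
  forall x y t : R, J x -> J y -> 0 <= t <= 1 ->
    g (x * y / (t * x + (1 - t) * y)) <= t * g y + (1 - t) * g x.

Definition C5 q u v : R :=
  ((u + v) / 2) `^ (1 - 2 * q) * ((v - 3 * u) / 2 - q * (v - u))
  + u `^ (2 - 2 * q).

Definition C6 q u v : R :=
  ((u + v) / 2) `^ (1 - 2 * q) * ((3 * v - u) / 2 - q * (v - u))
  + u `^ (1 - 2 * q) * (u - 2 * v + 2 * q * (v - u)).

End Defs.

(* Main.v *)
(* For {u, v} = {a, b} put Y s = u + s (v - u), X s = u v / Y s, and let H be an
   antiderivative of f x / x^2. The function s f (X s) + u v / (v - u) H (X s)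
   has derivative - u v (v - u) s f'(X s) / (Y s)^2, and adding its increments on
   [0, 1/2] for (u, v) = (a, b) and (b, a) yields the left-hand side of the
   inequality. Harmonic convexity bounds |f'(X s)|^q by
   s |f'(u)|^q + (1 - s) |f'(v)|^q. Hoelder's inequality is replaced by the
   pointwise Young inequality with a parameter t, optimised at the end: its
   right-hand side has an explicit antiderivative, so the increment is bounded
   by the mean value theorem and f' is never integrated. *)
Require Import Defs.
From mathcomp Require Import all_boot all_order all_algebra.
From mathcomp Require Import all_classical all_reals all_analysis.
From mathcomp Require Import ring lra.

Import Order.TTheory GRing.Theory Num.Theory numFieldNormedType.Exports.

Local Open Scope classical_set_scope.
Local Open Scope ring_scope.

(** * Continuity relative to an interval *)

Lemma derivable_within_cvg {R : realType} (I : set R) (f : R -> R) (x : R) :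
  derivable_within I f x -> f @ within I (nbhs x) --> f x.
Proof.
move=> /cvg_ex[l fl].
have Ixx : y - x @[y --> within I x^'] --> (0 : R).
  have : y - x @[y --> x] --> x - x.
    by apply: cvgB; [exact: cvg_id|exact: cvg_cst].
  by rewrite subrr => xx; do 2!apply: cvg_within_filter.
have fx : diff_quotient f x y * (y - x) + f x @[y --> within I x^'] --> f x.
  have := cvgD (cvgM fl Ixx) (cvg_cst (f x)).
  by rewrite mulr0 add0r; apply.
apply/cvgrPdist_lt => e e0.
move/cvgrPdist_lt : fx => /(_ _ e0); rewrite !near_withinE /= => fx.
near=> y => Iy.
(* The difference quotient is controlled only on the punctured filter, so [y = x] is split off;
   there the distance to be bounded is 0. *)
have [->|yx] := eqVneq y x; first by rewrite subrr normr0.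
have : `|f x - (diff_quotient f x y * (y - x) + f x)| < e.
  by move: yx Iy; near: y.
by rewrite /diff_quotient divfK ?subr_eq0// subrK.
Unshelve. all: by end_near.
Qed.

Lemma derivable_within_itv_continuous {R : realType} (I : set R) (f : R -> R)
    (a b : R) : `[a, b] `<=` I ->
  (forall x, x \in `[a, b] -> derivable_within I f x) ->
  {within `[a, b], continuous f}.
Proof.
move=> abI df; apply/subspace_continuousP => x xab.
move=> A /(derivable_within_cvg _ _ _ (df x xab)) fA.
suff : \forall y \near x, `[a, b]%classic y -> A (f y) by [].
by near=> y => /abI; near: y; exact: fA.
Unshelve. all: by end_near.
Qed.

(** Serves to compose [f] and [H] with the path [X]: both are continuous only relative to [[a, b]],
    and the path starts at an endpoint of that interval when [u] and [v] are [a] and [b]. *)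
Lemma within_continuous_comp_within {T U V : topologicalType} (A : set T)
    (B : set U) (f : T -> U) (g : U -> V) :
  (forall x, A x -> B (f x)) ->
  {within A, continuous f} -> {within B, continuous g} ->
  {within A, continuous g \o f}.
Proof.
move=> AB /subspace_continuousP cf /subspace_continuousP cg.
apply/subspace_continuousP => x Ax.
move=> C /(cg _ (AB _ Ax)) gC.
have fC : \forall y \near x, A y -> B (f y) -> C (g (f y)).
  exact: (cf _ Ax _ gC).
suff : \forall y \near x, A y -> C (g (f y)) by [].
by near=> y => Ay; apply: (near fC y) => //; exact: AB.
Unshelve. all: by end_near.
Qed.

(** * Turning the integral into an increment, and bounding increments through derivatives *)

Lemma within_continuous_antiderivative {R : realType} (h : R -> R) (a b : R) :
  a < b -> {within `[a, b], continuous h} ->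
  exists H : R -> R, [/\ {within `[a, b], continuous H},
    forall x, x \in `]a, b[ -> is_derive x 1 H (h x) &
    H b - H a = \int[lebesgue_measure]_(x in `[a, b]) h x].
Proof.
move=> ab ch.
have ih : lebesgue_measure.-integrable `[a, b] (EFin \o h).
  by apply: continuous_compact_integrable => //; exact: segment_compact.
exists (fun x => parameterized_integral lebesgue_measure a x h); split.
- exact: parameterized_integral_continuous (ltW ab) ih.
- move=> x xab; have [ax xb] := andP xab.
  have cx : {for x, continuous h} by exact: within_continuous_continuous xab.
  have [dH <-] := continuous_FTC1_closed xb ih ax cx.
  by rewrite derive1E; exact/derivableP.
- by rewrite /parameterized_integral set_itv1 Rintegral_set1 subr0.
Qed.

(** The mean value theorem is applied to [G - F] and to [G + F]: both have a nonnegative derivative,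
    and the two resulting inequalities are the two signs of the absolute value. *)
Lemma ler_norm_derive1 {R : realType} (F G dF dG : R -> R) (a b : R) :
  a < b ->
  {within `[a, b], continuous F} -> {within `[a, b], continuous G} ->
  (forall x, x \in `]a, b[ -> is_derive x 1 F (dF x)) ->
  (forall x, x \in `]a, b[ -> is_derive x 1 G (dG x)) ->
  (forall x, x \in `]a, b[ -> `|dF x| <= dG x) ->
  `|F b - F a| <= G b - G a.
Proof.
move=> ab cF cG FdF GdG dFG.
have ba0 : 0 <= b - a by rewrite subr_ge0 ltW.
have [x xab Ex] := MVT ab
  (fun x xab => is_deriveB (GdG x xab) (FdF x xab)) (within_continuousB cG cF).
have [y yab Ey] := MVT ab
  (fun x xab => is_deriveD (GdG x xab) (FdF x xab)) (within_continuousD cG cF).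
have xge0 : 0 <= dG x - dF x.
  by rewrite subr_ge0 (le_trans _ (dFG x xab))// ler_norm.
have yge0 : 0 <= dG y + dF y.
  by have := ler_norm (- dF y); have := dFG y yab; rewrite normrN; lra.
have := mulr_ge0 xge0 ba0; have := mulr_ge0 yge0 ba0.
rewrite -Ex -Ey !fctE ler_norml => ? ?; apply/andP; split; lra.
Qed.

(** * Young's inequality with a parameter, and its optimisation *)

Lemma weighted_young {R : realType} (p q t w k : R) :
  0 < p -> 0 < q -> 1 / p + 1 / q = 1 -> 0 < t -> 0 <= w -> 0 <= k ->
  w * k <= t * (w `^ p / p) + t `^ (1 - q) * (k `^ q / q).
Proof.
move=> p0 q0 pq t0 w0 k0.
have pE : 1 / p * p = 1 by rewrite div1r mulVf// gt_eqF.
have qE : - (1 / p) * q = 1 - q.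
  by rewrite (_ : 1 / p = 1 - 1 / q); [field; rewrite gt_eqF|lra].
(* Young's inequality is used for the factors [t^(1/p) w] and [t^(-1/p) k]. Their powers [p] and [q]
   produce the weights [t] and [t^(1-q)], since [-q/p = 1 - q]. *)
have tE : t `^ (1 / p) * w * (t `^ (- (1 / p)) * k) = w * k.
  by rewrite mulrACA -powRD ?(gt_eqF t0) ?implybT// addrN powRr0 mul1r.
rewrite -tE; apply: le_trans (conjugate_powR _ _ p0 q0 _) _.
- by rewrite mulr_ge0// powR_ge0.
- by rewrite mulr_ge0// powR_ge0.
- by rewrite -pq !div1r.
- rewrite !powRM ?powR_ge0// -!powRrM pE qE (powRr1 (ltW t0)).
  by rewrite !mulrA.
Qed.

(** The infimum over [t] of the Young bounds is the Hoelder product. It is attained when [B > 0],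
    and only approached as [t] tends to 0 when [B = 0]. *)
Lemma le_of_weighted_young {R : realType} (p q A B X : R) :
  1 < p -> 1 < q -> 1 / p + 1 / q = 1 -> 0 < A -> 0 <= B ->
  (forall t, 0 < t -> X <= t * (A / p) + t `^ (1 - q) * (B / q)) ->
  X <= A `^ (1 / p) * B `^ (1 / q).
Proof.
move=> p1 q1 pq A0; rewrite le_eqVlt => /predU1P[<-|B0] hX.
  have q0 : 1 / q != 0 by rewrite div1r invr_neq0// gt_eqF// (lt_trans _ q1).
  rewrite powR0// mulr0 leNgt; apply/negP => X0.
  (* With [B = 0] and [X > 0] this choice of [t] gives [X <= X / p], contradicting [1 < p]. *)
  have := hX (X / A) (divr_gt0 X0 A0); rewrite mul0r mulr0 addr0.
  rewrite mulrA divfK ?gt_eqF// ler_pdivlMr ?(lt_trans _ p1)//.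
  by rewrite ger_pMr// leNgt p1.
have pE : 1 / p = 1 - 1 / q by lra.
have q0 : q != 0 by rewrite gt_eqF// (lt_trans _ q1).
have BA0 : 0 < B / A by rewrite divr_gt0.
(* At the optimal [t = (B / A)^(1/q)] both [t A] and [t^(1-q) B] equal the target product, and the
   weights [1/p] and [1/q] add up to 1. *)
have tA : (B / A) `^ (1 / q) * A = A `^ (1 / p) * B `^ (1 / q).
  have {2}-> : A = A `^ (1 / q) * A `^ (1 / p).
    by rewrite -powRD ?(gt_eqF A0) ?implybT// addrC pq powRr1// ltW.
  by rewrite mulrA -powRM ?(ltW BA0) ?(ltW A0)// divfK ?gt_eqF// mulrC.
have tB : ((B / A) `^ (1 / q)) `^ (1 - q) * B = (B / A) `^ (1 / q) * A.
  rewrite -powRrM (_ : _ * (1 - q) = 1 / q - 1); last by field.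
  rewrite powRB ?(gt_eqF BA0) ?implybT// (powRr1 (ltW BA0)).
  by field; rewrite !gt_eqF.
apply: le_trans (hX _ (powR_gt0 (1 / q) BA0)) _.
rewrite !mulrA tB tA -mulrDr.
by rewrite -[p^-1]div1r -[q^-1]div1r pq mulr1.
Qed.

(** * The explicit antiderivative behind [C5] and [C6] *)

Lemma convex_comb_gt0 {R : realType} (u v s : R) : 0 < u -> 0 < v ->
  0 <= s <= 1 -> 0 < u + s * (v - u).
Proof.
move=> u0 v0 /andP[s0 s1].
have [->|s_neq0] := eqVneq s 0; first by rewrite mul0r addr0.
have : 0 < s by rewrite lt0r s_neq0.
by nra.
Qed.

Lemma is_derive_affine {R : realType} (u d s : R) :
  is_derive s 1 (fun t => u + t * d) d.
Proof.
have /is_derive_eq := is_deriveD (is_derive_cst u s 1)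
  (is_deriveM (is_derive_id s 1) (is_derive_cst d s 1)).
by apply; rewrite scaler0 !add0r [_ *: _]mulr1.
Qed.

Lemma is_derive_powR_affine {R : realType} (u d r s : R) : 0 < u + s * d ->
  is_derive s 1 (fun t => (u + t * d) `^ r) (r * (u + s * d) `^ (r - 1) * d).
Proof.
move=> Y0.
exact: (@is_derive1_comp _ (fun x => x `^ r) (fun t => u + t * d) s _ _
  (is_derive1_powR r Y0) (is_derive_affine u d s)).
Qed.

(** With [Y = u + s (v - u)] one has [s = (Y - u) / (v - u)] and [1 - s = (v - Y) / (v - u)], so the
    integrand is a combination of [Y^(1-2q)] and [Y^(-2q)]. [C5] and [C6] collect the coefficients
    of [Mu] and [Mv] in the increment over [[0, 1/2]]. *)
Lemma powR_antiderivative {R : realType} (u v q Mu Mv : R) :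
  0 < u -> 0 < v -> u != v -> 1 < q ->
  exists2 K : R -> R,
    forall s : R, 0 <= s <= 1 -> is_derive s 1 K
      ((u + s * (v - u)) `^ (- (2 * q)) * (s * Mu + (1 - s) * Mv)) &
    K (1 / 2) - K 0 = (C5 q u v * Mu + C6 q u v * Mv)
                      / (2 * ((1 - q) * (1 - 2 * q) * (v - u) ^+ 2)).
Proof.
move=> u0 v0 uv q1.
pose K (s : R) := (Mu - Mv) / ((2 - 2 * q) * (v - u) ^+ 2)
    * (u + s * (v - u)) `^ (2 - 2 * q)
  + (v * Mv - u * Mu) / ((1 - 2 * q) * (v - u) ^+ 2)
    * (u + s * (v - u)) `^ (1 - 2 * q).
have vu : v - u != 0 by rewrite subr_eq0 eq_sym.
have q2 : 1 - q != 0 by rewrite lt_eqF// subr_lt0.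
have q3 : 1 - 2 * q != 0 by apply/negP => /eqP; lra.
have q4 : 2 - 2 * q != 0 by apply/negP => /eqP; lra.
(* Lowering the larger exponent by one leaves a single power of each base, which [field] can treat
   as an atom. *)
have powS (x r : R) : 0 < x -> x `^ (r + 1) = x * x `^ r.
  by move=> x0; rewrite powRD ?(gt_eqF x0) ?implybT// powRr1 ?ltW// mulrC.
exists K => [s s01|].
  have Y0 : 0 < u + s * (v - u) by exact: convex_comb_gt0.
  have /is_derive_eq := is_deriveD
    (is_deriveZ ((Mu - Mv) / ((2 - 2 * q) * (v - u) ^+ 2))
       (is_derive_powR_affine _ _ (2 - 2 * q) _ Y0))
    (is_deriveZ ((v * Mv - u * Mu) / ((1 - 2 * q) * (v - u) ^+ 2))
       (is_derive_powR_affine _ _ (1 - 2 * q) _ Y0)).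
  apply; rewrite /GRing.scale /=.
  rewrite (_ : 2 - 2 * q - 1 = - (2 * q) + 1); last by ring.
  rewrite (_ : 1 - 2 * q - 1 = - (2 * q)); last by ring.
  by rewrite powS//; field; rewrite ?q3 ?q4 vu.
rewrite /K /C5 /C6 (_ : u + 1 / 2 * (v - u) = (u + v) / 2); last by field.
rewrite mul0r addr0 (_ : 2 - 2 * q = 1 - 2 * q + 1); last by ring.
have m0 : 0 < (u + v) / 2 by rewrite divr_gt0// addr_gt0.
rewrite !powS//; field; rewrite vu q2 q3 /=.
by apply/negP => /eqP; lra.
Qed.

(** * The bound for an increment over [[0, 1/2]] *)

Lemma within_continuous_powR {R : realType} (r b : R) : 0 < r -> 0 < b ->
  {within `[0, b], continuous (fun s : R => s `^ r)}.
Proof.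
move=> r0 b0; apply/(continuous_within_itvP _ b0).
have cpow (x : R) : 0 < x -> {for x, continuous (fun s : R => s `^ r)}.
  move=> x0; apply/differentiable_continuous/derivable1_diffP.
  by case: (is_derive1_powR r x0).
split.
- by move=> x; rewrite in_itv/= => /andP[x0 _]; exact: cpow.
(* The derivative rule covers positive bases only; at 0 the right limit agrees with the value 0
   because [r > 0]. *)
- by rewrite powR0 ?gt_eqF//; exact: powR_cvg0.
- exact/cvg_at_left_filter/cpow.
Qed.

(** Plays the part of Hoelder's inequality for the product of [s] and [D s] on [[0, 1/2]]: [A] below
    is the integral of [s^p], and [N / (2 * E)], the increment of [K], is that of the majorant of
    [D^q]. *)
Lemma increment_le_C5_C6 {R : realType} (u v p q c Mu Mv : R) (F dF D : R -> R) :
  0 < u -> 0 < v -> u != v -> 1 < p -> 1 < q -> 1 / p + 1 / q = 1 ->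
  0 <= c -> 0 <= Mu -> 0 <= Mv ->
  {within `[0, 1 / 2], continuous F} ->
  (forall s : R, s \in `]0, 1 / 2[ -> is_derive s 1 F (dF s)) ->
  (forall s : R, s \in `]0, 1 / 2[ -> `|dF s| <= c * (s * D s)) ->
  (forall s : R, s \in `]0, 1 / 2[ -> 0 <= D s) ->
  (forall s : R, s \in `]0, 1 / 2[ -> D s `^ q <=
     (u + s * (v - u)) `^ (- (2 * q)) * (s * Mu + (1 - s) * Mv)) ->
  `|F (1 / 2) - F 0| <= c / (4 * (p + 1) `^ (1 / p))
    * (1 / ((1 - q) * (1 - 2 * q) * (v - u) ^+ 2) `^ (1 / q))
    * (C5 q u v * Mu + C6 q u v * Mv) `^ (1 / q).
Proof.
move=> u0 v0 uv p1 q1 pq c0 Mu0 Mv0 cF FdF dFD D0 DqM.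
have p0 : 0 < p by rewrite (lt_trans _ p1).
have q0 : 0 < q by rewrite (lt_trans _ q1).
have h0 : 0 < 1 / 2 :> R by lra.
have [K dK KE] := powR_antiderivative u v q Mu Mv u0 v0 uv q1.
set N := C5 q u v * Mu + _ in KE *.
set E := (1 - q) * _ * _ in KE *.
have E0 : 0 < E.
  rewrite /E; have : 0 < (v - u) ^+ 2.
    by rewrite exprn_even_gt0//= subr_eq0 eq_sym.
  by move=> vu2; rewrite mulr_gt0//; nra.
have halfW (s : R) : s \in `]0, 1 / 2[ -> 0 <= s <= 1.
  by rewrite in_itv/= => /andP[? ?]; apply/andP; split; lra.
have cK : {within `[0, 1 / 2], continuous K}.
  apply: derivable_within_continuous => s; rewrite in_itv/= => /andP[s0 s1].
  by case: (dK s); first by apply/andP; split; lra.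
(* The sign of [N] is not visible from [C5] and [C6]; it follows from [K] having a nonnegative
   derivative. *)
have N0 : 0 <= N / (2 * E).
  rewrite -KE; have [s sI ->] := MVT h0 (fun s sI => dK s (halfW s sI)) cK.
  have /andP[s0 s1] := halfW s sI.
  rewrite subr0 (mulr_ge0 _ (ltW h0))// mulr_ge0 ?powR_ge0//.
  by rewrite addr_ge0// mulr_ge0// subr_ge0.
set A := (1 / 2 : R) `^ (p + 1) / (p + 1).
have A0 : 0 < A by rewrite divr_gt0 ?powR_gt0 ?addr_gt0.
have Young t : 0 < t ->
    `|F (1 / 2) - F 0| <= c * (t * (A / p) + t `^ (1 - q) * (N / (2 * E) / q)).
  move=> t0.
  (* [G] is an antiderivative of [c] times the Young majorant of [s * D s], with [D s ^ q] replaced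
     by its bound. *)
  pose G (s : R) := c * t / (p * (p + 1)) * s `^ (p + 1)
                    + c * t `^ (1 - q) / q * K s.
  have -> : c * (t * (A / p) + t `^ (1 - q) * (N / (2 * E) / q))
      = G (1 / 2) - G 0.
    rewrite -KE /G /A (@powR0 _ (p + 1)) ?gt_eqF ?addr_gt0//.
    by field; rewrite !gt_eqF ?addr_gt0.
  apply: (ler_norm_derive1 F G dF
    (fun s => c * (t * (s `^ p / p) + t `^ (1 - q)
      * ((u + s * (v - u)) `^ (- (2 * q)) * (s * Mu + (1 - s) * Mv) / q)))
    _ _ h0) => //.
  - apply: within_continuousD; apply: within_continuous_comp.
    + by move=> x _; exact: mulrl_continuous.
    + by apply: within_continuous_powR; rewrite ?addr_gt0.
    + by move=> x _; exact: mulrl_continuous.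
    + exact: cK.
  - move=> s sI; have /andP[s0 _] := sI.
    have /is_derive_eq := is_deriveD
      (is_deriveZ (c * t / (p * (p + 1))) (is_derive1_powR (p + 1) s0))
      (is_deriveZ (c * t `^ (1 - q) / q) (dK s (halfW s sI))).
    apply; rewrite /GRing.scale /= addrK.
    by field; rewrite !gt_eqF ?addr_gt0.
  - move=> s sI; apply: le_trans (dFD s sI) _; rewrite ler_wpM2l//.
    have /andP[s0 _] := halfW s sI.
    apply: le_trans (weighted_young p q t s (D s) p0 q0 pq t0 s0 (D0 s sI)) _.
    by rewrite lerD2l ler_wpM2l ?powR_ge0// ler_pM2r ?invr_gt0// DqM.
have XE : `|F (1 / 2) - F 0| <= c * (A `^ (1 / p) * (N / (2 * E)) `^ (1 / q)).
  (* The optimisation is done after division by [c], so [c = 0] is treated apart. *)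
  move: c0; rewrite le_eqVlt => /predU1P[c0|c0].
    by have := Young 1 ltr01; rewrite -c0 !mul0r.
  rewrite -ler_pdivrMl//; apply: le_of_weighted_young => // t t0.
  by rewrite ler_pdivrMl//; exact: Young.
apply: (le_trans XE); rewrite le_eqVlt; apply/orP; left; apply/eqP.
have N0' : 0 <= N by move: N0; rewrite pmulr_lge0// invr_gt0 mulr_gt0.
have powRV (x r : R) : 0 < x -> x^-1 `^ r = (x `^ r)^-1.
  by move=> x0; rewrite -(powR_inv1 (ltW x0)) -powRrM mulN1r powRN.
(* The exponents add up to [(p + 1)/p + 1/q = 2]; this is the source of the 4 in the denominator. *)
have pE : (1 / 2 : R) `^ (p + 1) `^ (1 / p) * (1 / 2) `^ (1 / q) = 1 / 4.
  rewrite -powRrM -powRD; last by rewrite (gt_eqF h0) implybT.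
  rewrite (_ : _ + _ = 2%:R); first by rewrite powR_mulrn; [field|exact: ltW].
  rewrite (_ : (p + 1) * (1 / p) = 1 + 1 / p); last by field; rewrite gt_eqF.
  by rewrite -addrA pq.
have P0 : 0 < p + 1 by rewrite addr_gt0.
have AE : A `^ (1 / p) = (1 / 2) `^ (p + 1) `^ (1 / p) / (p + 1) `^ (1 / p).
  by rewrite /A (@powRM _ _ (p + 1)^-1) ?powR_ge0 ?invr_ge0 ?(ltW P0)// powRV.
have BE : (N / (2 * E)) `^ (1 / q)
    = N `^ (1 / q) * ((1 / 2) `^ (1 / q) / E `^ (1 / q)).
  rewrite (_ : N / (2 * E) = N * (1 / 2 * E^-1)); last by field; rewrite gt_eqF.
  rewrite (@powRM _ N) ?(@powRM _ (1 / 2) E^-1) ?powRV//.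
  - by rewrite invr_ge0 ltW.
  - by rewrite mulr_ge0 ?(ltW h0)// invr_ge0 ltW.
rewrite AE BE (_ : c / _ = c * (1 / 4) / (p + 1) `^ (1 / p)); last first.
  by field; rewrite gt_eqF// powR_gt0.
by rewrite -pE; field; rewrite !gt_eqF ?powR_gt0.
Qed.

(** * The harmonic path and the estimate of one half *)

Lemma harmonic_comb_itv {R : realType} (a b u v s : R) :
  0 < a -> u \in `[a, b] -> v \in `[a, b] -> 0 <= s <= 1 ->
  u * v / (u + s * (v - u)) \in `[a, b].
Proof.
rewrite !in_itv/= => a0 /andP[au ub] /andP[av vb] /andP[s0 s1].
have u0 : 0 < u by rewrite (lt_le_trans a0).
have v0 : 0 < v by rewrite (lt_le_trans a0).
have Y0 : 0 < u + s * (v - u) by apply: convex_comb_gt0; rewrite // s0.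
rewrite ler_pdivlMr// ler_pdivrMr//; apply/andP; split; rewrite -subr_ge0.
(* Once the denominator [(1 - s) u + s v] is cleared, the gap to each endpoint is a sum of
   nonnegative products. *)
- rewrite (_ : _ - _ = (1 - s) * u * (v - a) + s * v * (u - a)); last by ring.
  by rewrite addr_ge0// !mulr_ge0 ?subr_ge0 ?(ltW u0) ?(ltW v0).
- rewrite (_ : _ - _ = (1 - s) * u * (b - v) + s * v * (b - u)); last by ring.
  by rewrite addr_ge0// !mulr_ge0 ?subr_ge0 ?(ltW u0) ?(ltW v0).
Qed.

(** The derivatives of [f] and [H] are given on the open interval only, hence the strict form. The
    larger of [u], [v] exceeds [a] and the smaller lies below [b], so each gap has a positive
    summand. *)
Lemma harmonic_comb_itvoo {R : realType} (a b u v s : R) :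
  0 < a -> u \in `[a, b] -> v \in `[a, b] -> u != v -> 0 < s < 1 ->
  u * v / (u + s * (v - u)) \in `]a, b[.
Proof.
rewrite !in_itv/= => a0 /andP[au ub] /andP[av vb] uv /andP[s0 s1].
have u0 : 0 < u by rewrite (lt_le_trans a0).
have v0 : 0 < v by rewrite (lt_le_trans a0).
have Y0 : 0 < u + s * (v - u) by apply: convex_comb_gt0; rewrite // !ltW.
have su : 0 < (1 - s) * u by rewrite mulr_gt0// subr_gt0.
have sv : 0 < s * v by rewrite mulr_gt0.
rewrite ltr_pdivlMr// ltr_pdivrMr// -(subr_gt0 (a * _)) -(subr_gt0 (u * v)).
rewrite (_ : _ - a * _ = (1 - s) * u * (v - a) + s * v * (u - a)); last by ring.
rewrite (_ : _ - u * v = (1 - s) * u * (b - v) + s * v * (b - u)); last by ring.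
have [uv'|vu|uv'] := ltgtP u v; last by rewrite uv' eqxx in uv.
- have [av' ub'] := (le_lt_trans au uv', lt_le_trans uv' vb).
  by apply/andP; split; [apply: ltr_wpDr|apply: ltr_wpDl];
    rewrite ?mulr_gt0 ?mulr_ge0 ?subr_gt0 ?subr_ge0// ltW.
- have [au' vb'] := (le_lt_trans av vu, lt_le_trans vu ub).
  by apply/andP; split; [apply: ltr_wpDl|apply: ltr_wpDr];
    rewrite ?mulr_gt0 ?mulr_ge0 ?subr_gt0 ?subr_ge0// ltW.
Qed.

Lemma is_derive_harmonic_comb {R : realType} (u v s : R) :
  u + s * (v - u) != 0 ->
  is_derive s 1 (fun t => u * v / (u + t * (v - u)))
    (- (u * v * (v - u)) / (u + s * (v - u)) ^+ 2).
Proof.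
move=> Y0; have /is_derive_eq := is_deriveZ (u * v)
  (@is_deriveV _ (fun t => u + t * (v - u)) s _ 1 Y0
     (is_derive_affine u (v - u) s)).
by apply; rewrite /GRing.scale /=; field.
Qed.

(** The order of [u] and [v] is left open, with [v - u] signed on the left and in absolute value on
    the right, so that one proof gives both halves. The path [X] runs from [v] at [s = 0] to the
    harmonic midpoint at [s = 1/2]. *)
Lemma half_midpoint_estimate {R : realType} (a b u v p q : R) (f df H : R -> R) :
  0 < a -> u \in `[a, b] -> v \in `[a, b] -> u != v ->
  1 < p -> 1 < q -> 1 / p + 1 / q = 1 ->
  {within `[a, b], continuous f} -> {within `[a, b], continuous H} ->
  (forall x, x \in `]a, b[ -> is_derive x 1 f (df x)) ->
  (forall x, x \in `]a, b[ -> is_derive x 1 H (f x / x ^+ 2)) ->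
  harmonically_convex_on `[a, b] (fun x => `|df x| `^ q) ->
  `|f (2 * u * v / (u + v)) / 2
    + u * v / (v - u) * (H (2 * u * v / (u + v)) - H v)|
  <= u * v * `|v - u| / (4 * (p + 1) `^ (1 / p))
    * (1 / ((1 - q) * (1 - 2 * q) * (v - u) ^+ 2) `^ (1 / q))
    * (C5 q u v * `|df u| `^ q + C6 q u v * `|df v| `^ q) `^ (1 / q).
Proof.
move=> a0 uab vab uv p1 q1 pq cf cH fdf HdH hconv.
have u0 : 0 < u by rewrite (lt_le_trans a0)// (itvP uab).
have v0 : 0 < v by rewrite (lt_le_trans a0)// (itvP vab).
have vu : v - u != 0 by rewrite subr_eq0 eq_sym.
pose Y (s : R) := u + s * (v - u).
pose X (s : R) := u * v / Y s.
have Ygt0 (s : R) : 0 <= s <= 1 -> 0 < Y s by exact: convex_comb_gt0.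
have Y_neq0 (s : R) : 0 <= s <= 1 -> Y s != 0 by move=> /Ygt0/gt_eqF ->.
have halfW (s : R) : s \in `[0, 1 / 2] -> 0 <= s <= 1.
  by rewrite in_itv/= => /andP[? ?]; apply/andP; split; lra.
have halfoo (s : R) : s \in `]0, 1 / 2[ -> 0 < s < 1.
  by rewrite in_itv/= => /andP[? ?]; apply/andP; split; lra.
have halfooW (s : R) : s \in `]0, 1 / 2[ -> 0 <= s <= 1.
  by move=> /halfoo/andP[? ?]; rewrite !ltW.
have Xab (s : R) : s \in `]0, 1 / 2[ -> X s \in `]a, b[.
  by move=> /halfoo; exact: harmonic_comb_itvoo.
have dX (s : R) : 0 <= s <= 1 -> is_derive s 1 X (- (u * v * (v - u)) / Y s ^+ 2).
  by move=> /Y_neq0; exact: is_derive_harmonic_comb.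
have cX : {within `[0, 1 / 2], continuous X}.
  by apply: derivable_within_continuous => s /halfW s01; case: (dX s s01).
have cXcomp (g : R -> R) : {within `[a, b], continuous g} ->
    {within `[0, 1 / 2], continuous g \o X}.
  apply: within_continuous_comp_within cX => s /halfW.
  exact: harmonic_comb_itv.
(* The coefficient of [H] makes the derivative of the second term equal to [- f (X s)], which
   cancels the [f (X s)] from the product rule and leaves only the term in [df]. *)
pose F (s : R) : R := s * f (X s) + u * v / (v - u) * H (X s).
pose dF (s : R) : R := - (s * df (X s) * (u * v * (v - u)) / Y s ^+ 2).
pose D (s : R) : R := `|df (X s)| / Y s ^+ 2.
have X0 : X 0 = v by rewrite /X /Y mul0r addr0 mulrAC divff ?mul1r// gt_eqF.
have Xh : X (1 / 2) = 2 * u * v / (u + v).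
  by rewrite /X /Y; field; rewrite gt_eqF ?addr_gt0//; apply/negP => /eqP; lra.
have FE : f (2 * u * v / (u + v)) / 2
    + u * v / (v - u) * (H (2 * u * v / (u + v)) - H v) = F (1 / 2) - F 0.
  by rewrite /F X0 Xh; field.
have c0 : 0 <= u * v * `|v - u| by rewrite !mulr_ge0// ltW.
have cF : {within `[0, 1 / 2], continuous F}.
  move=> s; apply: cvgD; apply: cvgM.
  + by apply: continuous_subspaceT => ?; exact: cvg_id.
  + exact: (cXcomp f cf).
  + exact: cvg_cst.
  + exact: (cXcomp H cH).
have FdF (s : R) : s \in `]0, 1 / 2[ -> is_derive s 1 F (dF s).
  move=> sI; have Xs := Xab s sI; have ds := dX s (halfooW s sI).
  have /is_derive_eq := is_deriveD
    (is_deriveM (is_derive_id s 1)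
      (@is_derive1_comp _ f X s _ _ (fdf _ Xs) ds))
    (is_deriveZ (u * v / (v - u))
      (@is_derive1_comp _ H X s _ _ (HdH _ Xs) ds)).
  apply; rewrite /GRing.scale /= /dF /X.
  have Ys := Y_neq0 s (halfooW s sI).
  by field; rewrite vu Ys !gt_eqF.
have dFD (s : R) : s \in `]0, 1 / 2[ -> `|dF s| <= u * v * `|v - u| * (s * D s).
  move=> sI; have /andP[s0 _] := halfooW s sI.
  rewrite /dF /D normrN !normrM normfV (ger0_norm s0) (gtr0_norm u0).
  rewrite (gtr0_norm v0) (ger0_norm (exprn_even_ge0 _ _))//.
  by rewrite le_eqVlt; apply/orP; left; apply/eqP; ring.
have D0 (s : R) : s \in `]0, 1 / 2[ -> 0 <= D s.
  by move=> sI; rewrite divr_ge0// exprn_even_ge0.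
have DqM (s : R) : s \in `]0, 1 / 2[ -> D s `^ q <=
    Y s `^ (- (2 * q)) * (s * `|df u| `^ q + (1 - s) * `|df v| `^ q).
  move=> sI; have s01 := halfooW s sI.
  have YE : (Y s ^- 2) `^ q = Y s `^ (- (2 * q)).
    rewrite -powR_mulrn ?(ltW (Ygt0 s s01))// -powRN -powRrM; congr (_ `^ _).
    by rewrite mulNr.
  rewrite /D powRM// ?invr_ge0 ?exprn_even_ge0// YE mulrC ler_wpM2l ?powR_ge0//.
  (* Convexity is used with [x = v] and [y = u]: its definition attaches [t] to [x] in the
     denominator but to [g y] in the bound. *)
  have -> : X s = v * u / (s * v + (1 - s) * u).
    by rewrite /X /Y [u * v]mulrC; congr (_ / _); ring.
  exact: hconv v u s vab uab s01.
rewrite FE.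
exact: (increment_le_C5_C6 u v p q _ _ _ F dF D u0 v0 uv p1 q1 pq c0
  (powR_ge0 _ _) (powR_ge0 _ _) cF FdF dFD D0 DqM).
Qed.

(** * The two halves combined *)

Theorem corollary7 (R : realType) (I : set R) (f : R -> R) (a b p q : R)
  (I_itv : is_interval I) (I_pos : I `<=` [set x | 0 < x])
  (f_diff : forall x, I° x -> derivable f x 1)
  (Ia : I a) (Ib : I b) (ab : a < b)
  (f_diff_ab : forall x, x \in `[a, b] -> derivable_within I f x)
  (df_int : lebesgue_measure.-integrable `[a, b]
              (fun x => (derive_within I f x)%:E))
  (q1 : 1 < q) (pq : 1 / p + 1 / q = 1)
  (df_hconv : harmonically_convex_on `[a, b]
                (fun x => `|derive_within I f x| `^ q)) :
  let df := derive_within I f in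
  `| f (2 * a * b / (a + b))
     - a * b / (b - a) * \int[lebesgue_measure]_(x in `[a, b]) (f x / x ^+ 2) |
  <= a * b * (b - a) / (4 * (p + 1) `^ (1 / p))
     * (1 / ((1 - q) * (1 - 2 * q) * (b - a) ^+ 2) `^ (1 / q))
     * ((C5 q a b * `|df a| `^ q + C6 q a b * `|df b| `^ q) `^ (1 / q)
        + (C6 q b a * `|df a| `^ q + C5 q b a * `|df b| `^ q) `^ (1 / q)).
Proof.
lazy zeta; set df := derive_within I f.
have a0 : 0 < a by exact: I_pos.
have q0 : 0 < q by rewrite (lt_trans _ q1).
(* [1 / p = 1 - 1 / q] lies strictly between 0 and 1; this yields first [0 < p], then [1 < p]. *)
have p1 : 1 < p.
  have ip : 1 / p = 1 - 1 / q by lra.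
  have iq : 1 / q < 1 by rewrite ltr_pdivrMr// mul1r.
  have iq0 : 0 < 1 / q by rewrite divr_gt0.
  have p0 : 0 < p by rewrite -invr_gt0 -div1r ip subr_gt0.
  have : 1 / p < 1 by lra.
  by rewrite ltr_pdivrMr// mul1r.
have abI : `[a, b] `<=` I.
  by move=> x /=; rewrite in_itv/= => /I_itv; exact.
have cf := derivable_within_itv_continuous I f a b abI f_diff_ab.
have fdf x : x \in `]a, b[ -> is_derive x 1 f (df x).
  (* Points of []a, b[] are interior to [I], where the relative derivative is the ordinary one. *)
  move=> xab; have Ix : I° x.
    apply: (@interiorS _ `]a, b[); last first.
      by rewrite /interior; exact: near_in_itvoo.
    by apply: subset_trans abI; exact: subset_itv_oo_cc.
  by rewrite /df derive_within_interior// derive1E; exact/derivableP/f_diff.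
have ch : {within `[a, b], continuous (fun x => f x / x ^+ 2)}.
  move=> x; apply: cvgM; first exact: cf.
  move: x; apply: continuous_in_subspaceT => x.
  rewrite inE/= in_itv/= => /andP[ax _].
  apply: cvgV; last exact: exprn_continuous.
  by rewrite expf_neq0// gt_eqF// (lt_le_trans a0).
have [H [cH HdH HE]] := within_continuous_antiderivative _ _ _ ab ch.
have aab : a \in `[a, b] by rewrite in_itv/= lexx ltW.
have bab : b \in `[a, b] by rewrite in_itv/= lexx ltW.
have ba0 : 0 < b - a by rewrite subr_gt0.
have left_half := half_midpoint_estimate a b a b p q f df H a0 aab bab (negbT (lt_eqF ab))
  p1 q1 pq cf cH fdf HdH df_hconv.
have right_half := half_midpoint_estimate a b b a p q f df H a0 bab aab (negbT (gt_eqF ab))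
  p1 q1 pq cf cH fdf HdH df_hconv.
rewrite -HE.
(* The instance with [u = b] and [v = a] is brought to the same midpoint and the same constant as
   the other one. *)
move: right_half; rewrite [b + a]addrC -[2 * b * a]mulrA [b * a]mulrC mulrA.
rewrite -[a - b]opprB normrN sqrrN => right_half.
move: left_half right_half; rewrite (gtr0_norm ba0).
move: (`|df a| `^ q) (`|df b| `^ q) => Ma Mb.
move: (C5 q a b) (C6 q a b) (C5 q b a) (C6 q b a) => c5 c6 c5' c6'.
rewrite [c6' * _ + _]addrC.
set m := 2 * a * b / (a + b).
set c := a * b * (b - a) / (4 * _) * _ => left_half right_half.
(* The prefactors of the two [H] increments are opposite, so [H m] cancels and [H b - H a] remains,
   while the halves of [f m] add up. *)
rewrite (_ : f m - _ = (f m / 2 + a * b / (b - a) * (H m - H b))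
  + (f m / 2 + a * b / - (b - a) * (H m - H a))); last first.
  by field; rewrite gt_eqF.
by rewrite (mulrDr c); apply: le_trans (ler_normD _ _) _; exact: lerD.
Qed.
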